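(* Let $G$ be a group of bounded exponent. Then any approximate subgroup of $G$ is commensurable to a subgroup.
   Context: Subsets $X,Y$ of a group are commensurable if each is covered by finitely many right translates of the other. A symmetric subset $\Lambda\subset G$ ($1\in\Lambda=\Lambda^{-1}$) is an approximate subgroup if $\Lambda$ and $\Lambda^2=\{ab:a,b\in\Lambda\}$ are commensurable. $G$ has bounded exponent if there is $n\ge1$ with $g^n=1$ for all $g\in G$. *)

(* Defs.v *)
From mathcomp Require Import all_boot.
From mathcomp Require Import mathcomp_extra boolp classical_sets cardinality.

Set Implicit Arguments.
Unset Strict Implicit.
Unset Printing Implicit Defensive.

Local Open Scope classical_set_scope.
Local Open Scope group_scope.

Definition bounded_exponent (G : groupType) : Prop :=
  exists2 n : nat, (0 < n)%N & forall g : G, g ^+ n = 1.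

Definition right_translate (G : groupType) (X : set G) (g : G) : set G :=
  [set x * g | x in X].

Definition prod_set (G : groupType) (X Y : set G) : set G :=
  [set x * y | x in X & y in Y].

Definition covered (G : groupType) (X Y : set G) : Prop :=
  exists2 F : set G, finite_set F & X `<=` \bigcup_(g in F) right_translate Y g.

Definition commensurable (G : groupType) (X Y : set G) : Prop :=
  covered X Y /\ covered Y X.

Definition symmetric_set (G : groupType) (X : set G) : Prop :=
  X 1 /\ X = [set x^-1 | x in X].

Definition approximate_subgroup (G : groupType) (L : set G) : Prop :=
  symmetric_set L /\ commensurable L (prod_set L L).

Definition subgroup (G : groupType) (H : set G) : Prop :=
  group_closed (mem H).

(* Main.v *)
(* Call S thick if S is symmetric, contains 1 and finitely many translates of
   S cover L. If S is thick then so is the set of x all of whose conjugates by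
   L^w lie in S^4. Since g^n = 1, long words in a set that is stable under such
   conjugations can be shortened by extracting a subword close to the n-th
   power of a letter; this yields, for every C, some m and a thick S with
   S^(Cm) inside L^m. For such an S and E a bounded power of S, the sets
   L E^(jN) with jN bounded by a multiple of m stay inside L^(m+1), so for some
   j the fractional covering number grows by at most 3/2 from A = L E^(jN) to
   A' = A E^N.

   Let Q be a much smaller thick set. For a bump function theta_x supported on
   xA' and psi equal to 1 on A and supported on Q^t A, let phi(x) be the
   covering number of (1 + psi) theta_x. Along the orbit x, qx, ..., q^(n-1) x
   of q in Q the increments of phi almost coincide, and their sum is 0 because
   q^n = 1; so phi is Lipschitz with a small constant. As phi(1) is at least
   4/3 of the covering number of A', phi(x) exceeds that of theta_x for all x
   in Q^(2t), so psi theta_x is not 0 and x lies in Q^t A A'^-1. So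
   doubling the exponent only costs a bounded factor, and counting
   L^2-separated points of Q^t in a fixed power of L shows that all the powers
   of Q stay in one power of L. Their union is the required subgroup. *)
Require Import Defs.
From mathcomp Require Import all_boot all_order all_algebra.
From mathcomp Require Import mathcomp_extra boolp classical_sets cardinality.
From mathcomp Require Import reals Rstruct.
From mathcomp Require Import zify ring lra.

Set Implicit Arguments.
Unset Strict Implicit.
Unset Printing Implicit Defensive.

Import Order.TTheory GRing.Theory Num.Theory.

Local Open Scope classical_set_scope.
Local Open Scope group_scope.

(** * Powers of a subset *)

Section Powers.
Variable G : groupType.
Implicit Types (A B S : set G) (x y g : G).

Definition pow_set A k : set G := iter k (prod_set A) [set 1].

Definition sym_set A := forall x, A x -> A x^-1.

(** The relation [covered B S] with the arguments exchanged and a list in place of the finite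
    set. *)
Definition right_covers S B :=
  exists F : seq G, forall x, B x -> exists2 f, f \in F & S (x * f^-1).

Definition conj_core B A : set G := [set x | forall g, B g -> A (g * x * g^-1)].

Lemma pow_set0 A x : pow_set A 0 x <-> x = 1.
Proof. by []. Qed.

Lemma pow_setS A k x :
  pow_set A k.+1 x <-> exists y z, [/\ A y, pow_set A k z & x = y * z].
Proof.
split=> [[y Ay [z Az <-]]|[y [z [Ay Az ->]]]]; first by exists y, z.
by exists y => //; exists z.
Qed.

Lemma pow_set1 A x : pow_set A 1 x <-> A x.
Proof.
rewrite pow_setS; split=> [[y [z [Ay /pow_set0 -> ->]]]|Ax]; first by rewrite mulg1.
by exists x, 1; rewrite mulg1.
Qed.

Lemma pow_set_mul A i j x y :
  pow_set A i x -> pow_set A j y -> pow_set A (i + j) (x * y).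
Proof.
elim: i x => [|i IH] x; first by move=> /pow_set0 ->; rewrite mul1g.
move=> /pow_setS[u [v [Au Av ->]]] Ay.
by rewrite addSn; apply/pow_setS; exists u, (v * y); split; rewrite ?mulgA//; apply: IH.
Qed.

Lemma pow_set_split A i j x : pow_set A (i + j) x ->
  exists y z, [/\ pow_set A i y, pow_set A j z & x = y * z].
Proof.
elim: i x => [|i IH] x; first by exists 1, x; rewrite mul1g.
move=> /pow_setS[u [v [Au /IH[y [z [Ay Az ->]]] ->]]].
by exists (u * y), z; split; rewrite ?mulgA//; apply/pow_setS; exists u, y.
Qed.

Lemma pow_set_le A i j x : A 1 -> (i <= j)%N -> pow_set A i x -> pow_set A j x.
Proof.
move=> A1 /subnK <- Ax; rewrite -[x]mul1g; apply: pow_set_mul Ax.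
by elim: (j - i)%N => // k IH; apply/pow_setS; exists 1, 1; rewrite mul1g.
Qed.

Lemma pow_set_one A k : A 1 -> pow_set A k 1.
Proof. by move=> A1; apply: (@pow_set_le A 0). Qed.

Lemma pow_setV A k x : sym_set A -> pow_set A k x -> pow_set A k x^-1.
Proof.
move=> As; elim: k x => [|k IH] x; first by move=> /pow_set0 ->; rewrite invg1.
move=> /pow_setS[y [z [Ay Az ->]]]; rewrite invgM -addn1.
by apply: pow_set_mul; [exact: IH | apply/pow_set1; exact: As].
Qed.

Lemma pow_set_sym A k : sym_set A -> sym_set (pow_set A k).
Proof. by move=> As x; apply: pow_setV. Qed.

Lemma pow_set_sub A B k : A `<=` B -> pow_set A k `<=` pow_set B k.
Proof.
move=> AB; elim: k => [|k IH] x //= /pow_setS[y [z [Ay Az ->]]].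
by apply/pow_setS; exists y, z; split=> //; [apply: AB | apply: IH].
Qed.

Lemma pow_set_pow A i j x : pow_set (pow_set A i) j x <-> pow_set A (j * i) x.
Proof.
elim: j x => [|j IH] x //; rewrite pow_setS mulSn; split.
  by move=> [y [z [Ay /IH Az ->]]]; apply: pow_set_mul.
by move=> /pow_set_split[y [z [Ay /IH Az ->]]]; exists y, z.
Qed.

Lemma pow_set_conj A B k g x : (forall y, A y -> B (g * y * g^-1)) ->
  pow_set A k x -> pow_set B k (g * x * g^-1).
Proof.
move=> AB; elim: k x => [|k IH] x.
  by move=> /pow_set0 ->; rewrite mulg1 mulgV.
move=> /pow_setS[y [z [Ay Az ->]]]; apply/pow_setS.
exists (g * y * g^-1), (g * z * g^-1); split; [exact: AB | exact: IH |].
by rewrite !mulgA mulgVK.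
Qed.

Lemma pow_set_expg A k x : A x -> pow_set A k (x ^+ k).
Proof.
move=> Ax; elim: k => [|k IH]; first by rewrite expg0.
by rewrite expgS; apply/pow_setS; exists x, (x ^+ k).
Qed.

Lemma right_covers_trans A B S :
  right_covers S A -> right_covers A B -> right_covers S B.
Proof.
move=> [F FP] [E EP]; exists [seq f * e | f <- F, e <- E] => x /EP[e Ee /FP[f Ff Sx]].
exists (f * e); first by apply/allpairsP; exists (f, e).
by rewrite invgM mulgA.
Qed.

Lemma right_covers_sub A B S : A `<=` B -> right_covers S B -> right_covers S A.
Proof. by move=> AB [F FP]; exists F => x /AB/FP. Qed.

(** If A^(k+1) lies in A E and A^2 in A F, then A^(k+2) lies in A^2 E, hence in A F E. *)
Lemma right_covers_pow A S : right_covers A (pow_set A 2) -> right_covers S A ->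
  forall k, right_covers S (pow_set A k.+1).
Proof.
move=> [F FP] cSA k; apply: right_covers_trans cSA _; elim: k => [|k [E EP]].
  by exists [:: 1] => x /pow_set1 Ax; exists 1; rewrite ?inE// invg1 mulg1.
exists [seq f * e | f <- F, e <- E] => x /pow_setS[y [z [Ay /EP[e Ee Az] ->]]].
have [|f Ff Ayz] := FP (y * (z * e^-1)).
  by rewrite -[2]/(1 + 1)%N; apply: pow_set_mul; apply/pow_set1.
exists (f * e); first by apply/allpairsP; exists (f, e).
by rewrite invgM !mulgA in Ayz *.
Qed.

End Powers.

Arguments pow_set : simpl never.

(** * Thick sets *)

Lemma nat_finType_collision (T : finType) (f : nat -> T) :
  exists l j, (l < j)%N /\ f l = f j.
Proof.
have : ~~ injectiveb (fun i : 'I_#|T|.+1 => f i).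
  apply/injectiveP => /leq_card; rewrite card_ord; lia.
move=> /injectivePn[i [j ij fij]].
have [lt_ij|lt_ji|eq_ij] := ltngtP i j.
- by exists i, j.
- by exists j, i.
- by rewrite (val_inj eq_ij) eqxx in ij.
Qed.

Section Thick.
Variable G : groupType.
Implicit Types (A B S L : set G) (x y g : G).

Definition thick L S := [/\ S 1, sym_set S & right_covers S L].

Lemma thick_cover L S k : thick L L -> right_covers L (pow_set L 2) -> thick L S ->
  right_covers S (pow_set L k).
Proof.
move=> [L1 _ _] cL [_ _ cS].
apply: right_covers_sub (right_covers_pow cL cS k) => x.
exact: pow_set_le.
Qed.

Lemma right_covers_self A : right_covers A A.
Proof. by exists [:: 1] => x Ax; exists 1; rewrite ?inE// invg1 mulg1. Qed.

Lemma conj_core_sub A B : B 1 -> conj_core B A `<=` A.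
Proof. by move=> B1 x /(_ _ B1); rewrite mul1g invg1 mulg1. Qed.

(* If [x_j x_l^-1] escapes the core for all [l < j], pick witnesses [g_(l,j)]
   and colour the pair [(l, j)] by the classes modulo [S] of [g_(l,j)] and of
   [g_(l,j) x_j]. Two consecutive pairs [(k, l)], [(l, j)] of the same colour
   would put [g x_j x_l^-1 g^-1 = (g x_j)(h x_l)^-1 (h g^-1)] in [S^4], with
   [g = g_(l,j)] and [h = g_(k,l)]; but the set of colours of the pairs
   [(k, l)] cannot be injective in [l]. *)
Lemma conj_core_thick L S w : thick L L -> right_covers L (pow_set L 2) ->
  thick L S -> thick L (conj_core (pow_set L w) (pow_set S 4)).
Proof.
move=> tL cL tS; have [S1 Ss _] := tS; have [L1 _ _] := tL.
have [F1 F1P] := thick_cover w tL cL tS.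
have [F2 F2P] := thick_cover (w + 1) tL cL tS.
set D := conj_core _ _.
split.
- by move=> g _; rewrite mulg1 mulgV; apply: pow_set_one.
- move=> x Dx g /Dx /(pow_setV Ss); by rewrite !invgM invgK mulgA.
apply: contrapT => nc.
have /choice[nxt nxtP] : forall F : seq G, exists x,
    L x /\ forall f, f \in F -> ~ D (x * f^-1).
  move=> F; apply: contrapT => nF; apply: nc; exists F => x Lx.
  apply: contrapT => nx; apply: nF; exists x; split=> // f Ff Dxf.
  by apply: nx; exists f.
pose xs := fix xs i := if i is j.+1 then nxt (xs j) :: xs j else [::].
pose x i := nxt (xs i).
have xsP l j : (l < j)%N -> x l \in xs j.
  elim: j => // j IH; rewrite ltnS leq_eqVlt inE => /orP[/eqP->|/IH ->].
    by rewrite eqxx.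
  by rewrite orbT.
have Lx i : L (x i) by case: (nxtP (xs i)).
have /choice[g gP] : forall p : nat * nat, exists g, (p.1 < p.2)%N ->
    pow_set L w g /\ ~ pow_set S 4 (g * (x p.2 * (x p.1)^-1) * g^-1).
  move=> [l j] /=; have [lt_lj|] := boolP (l < j)%N; last by exists 1.
  have [_ /(_ _ (xsP _ _ lt_lj)) nD] := nxtP (xs j).
  by move: nD => /existsNP[g /not_implyP[Lg nS]]; exists g.
have /choice[c1 c1P] : forall g, exists f, pow_set L w g -> f \in F1 /\ S (g * f^-1).
  move=> h; have [/F1P[f Ff Sf]|nL] := pselect (pow_set L w h); first by exists f.
  by exists 1.
have /choice[c2 c2P] : forall g, exists f,
    pow_set L (w + 1) g -> f \in F2 /\ S (g * f^-1).
  move=> h; have [/F2P[f Ff Sf]|nL] := pselect (pow_set L (w + 1) h).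
    by exists f.
  by exists 1.
pose col l j := (c1 (g (l, j)), c2 (g (l, j) * x j)).
pose colours := [seq (f1, f2) | f1 <- F1, f2 <- F2].
pose C j := [tuple of map (fun p => `[< exists2 l, (l < j)%N & col l j = p >])
  (in_tuple colours)].
have Lgx l j : (l < j)%N -> pow_set L (w + 1) (g (l, j) * x j).
  by move=> /(gP (l, j))[Lg _]; apply: pow_set_mul => //; apply/pow_set1.
have colP l j : (l < j)%N -> col l j \in colours.
  move=> lt_lj; apply/allpairsP; exists (col l j); split=> //=.
    by case: (c1P (g (l, j)) (gP (l, j) lt_lj).1).
  by case: (c2P _ (Lgx _ _ lt_lj)).
have [l [j [lt_lj /(congr1 val)/= Clj]]] := nat_finType_collision C.
have [k lt_kl col_kl] : exists2 k, (k < l)%N & col k l = col l j.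
  have /eq_in_map/(_ _ (colP _ _ lt_lj)) := Clj.
  by move=> /= E; apply/asboolP; rewrite E; apply/asboolP; exists l.
case: col_kl => e1 e2.
have [Lg ngj] := gP (l, j) lt_lj; apply: ngj => /=.
have [Lh _] := gP (k, l) lt_kl.
have [_ Sg] := c1P _ Lg; have [_ Sh] := c1P _ Lh.
have [_ Sgx] := c2P _ (Lgx _ _ lt_lj); have [_ Shx] := c2P _ (Lgx _ _ lt_kl).
move: Sg Sh Sgx Shx; rewrite e1 e2.
set a := g (l, j); set b := g (k, l); set u := c1 _; set v := c2 _.
move=> Sg Sh Sgx Shx.
have -> : a * (x j * (x l)^-1) * a^-1 =
  (a * x j * v^-1) * ((b * x l * v^-1)^-1 * ((b * u^-1) * ((a * u^-1)^-1))).
  by rewrite !invgM !invgK !mulgA !mulgVK.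
rewrite -[4%N]/(1 + (1 + (1 + 1)))%N.
do 2![apply: pow_set_mul; first by apply/pow_set1 => //; apply: Ss].
by apply: pow_set_mul; apply/pow_set1 => //; apply: Ss.
Qed.

End Thick.

(** * Thick sets of slow growth *)

Lemma count_pigeonhole (T U : eqType) (c : T -> U) (F : seq U) N (s : seq T) :
    (size F * N < size s)%N -> {in s, forall x, c x \in F} ->
  exists2 f, f \in F & (N < count (fun x => c x == f) s)%N.
Proof.
elim: F s => [|f F IH] s /=.
  by case: s => // x s _ /(_ x); rewrite inE eqxx /= => /(_ isT).
move=> sizes cs; have [ltN|leN] := ltnP N (count (fun x => c x == f) s).
  by exists f => //; rewrite inE eqxx.
have [||f' Ff' ltN] := IH [seq x <- s | c x != f].
- have eqs := count_predC (fun x => c x == f) s.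
  rewrite size_filter; move: eqs sizes.
  rewrite (@eq_count _ (predC _) (fun x => c x != f))// => <-.
  by rewrite mulSn; lia.
- move=> x; rewrite mem_filter => /andP[cxf /cs].
  by rewrite inE (negPf cxf).
- exists f'; first by rewrite inE Ff' orbT.
  apply: leq_trans ltN _; rewrite count_filter.
  by apply: sub_count => x /= /andP[].
Qed.

Section Collect.
Variable G : groupType.
Implicit Types (A B S L : set G) (x y g : G) (s t : seq G).

Lemma pow_set_prod A s :
  {in s, forall x, A x} -> pow_set A (size s) (\prod_(x <- s) x).
Proof.
elim: s => [|x s IH] As; first by rewrite big_nil; apply/pow_set0.
rewrite big_cons; apply/pow_setS; exists x, (\prod_(y <- s) y); split=> //.
  by apply: As; rewrite inE eqxx.
by apply: IH => y ys; apply: As; rewrite inE ys orbT.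
Qed.

Lemma pow_set_seq A k x : pow_set A k x ->
  exists s, [/\ size s = k, {in s, forall y, A y} & x = \prod_(y <- s) y].
Proof.
elim: k x => [|k IH] x.
  by move=> /pow_set0 ->; exists [::]; rewrite big_nil.
move=> /pow_setS[y [z [Ay /IH[s [<- As ->]] ->]]]; exists (y :: s).
split=> //; last by rewrite big_cons.
by move=> u; rewrite inE => /orP[/eqP ->|/As].
Qed.

(** The letters of [t] are moved to the front; a letter a that some of them jump over becomes p^-1 a
    p, with p their product. *)
Lemma prod_subseq t s : subseq t s -> exists s',
  [/\ size s = (size t + size s')%N,
      \prod_(x <- s) x = (\prod_(x <- t) x) * \prod_(x <- s') x &
      forall x', x' \in s' -> exists x u, [/\ x \in s, subseq u t &
        x' = (\prod_(y <- u) y)^-1 * x * \prod_(y <- u) y]].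
Proof.
elim: s t => [|a s IH] t.
  by rewrite subseq0 => /eqP ->; exists [::]; rewrite !big_nil mulg1.
case: t => [|x t].
  move=> _; exists (a :: s); rewrite !big_nil mul1g; split=> // y ys.
  by exists y, [::]; rewrite big_nil invg1 mul1g mulg1.
rewrite [subseq _ _]/=; have [->|_] := eqVneq x a => /IH[s' [sizes prods s'P]].
  exists s'; split; rewrite /= ?sizes ?big_cons ?prods ?mulgA// => y /s'P[z [u [zs ut ->]]].
  exists z, u; split=> //; first by rewrite inE zs orbT.
  exact: subseq_trans ut (subseq_cons _ _).
set p := \prod_(y <- x :: t) y in prods.
exists (p^-1 * a * p :: s'); split; first by rewrite /= sizes addnS.
  by rewrite -/p big_cons prods [X in _ = p * X]big_cons !mulgA mulgV mul1g.
move=> y; rewrite inE => /orP[/eqP ->|/s'P[z [u [zs ut ->]]]].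
  by exists a, (x :: t); split; rewrite ?inE ?eqxx.
by exists z, u; rewrite inE zs orbT.
Qed.

Variable L : set G.
Hypothesis tL : thick L L.
Hypothesis cL : right_covers L (pow_set L 2).

Let L1 : L 1. Proof. by case: tL. Qed.
Let Ls : sym_set L. Proof. by case: tL. Qed.

(* By pigeonhole the letters can be chosen so that replacing any of them by a
   later letter [y] changes the partial products only inside [L^2]. *)
Lemma subseq_near_power b n : exists N, forall s, (N <= size s)%N ->
  {in s, forall x, pow_set L b x} -> exists t y,
  [/\ subseq t s, size t = n & pow_set L (2 * n) ((\prod_(x <- t) x) * y ^- n)].
Proof.
have [F FP] := thick_cover (b * n) tL cL tL.
have /choice[c cP] : forall h, exists f,
    pow_set L (b * n) h -> f \in F /\ L (h * f^-1).
  move=> h; have [/FP[f Ff Lf]|nL] := pselect (pow_set L (b * n) h).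
    by exists f.
  by exists 1.
(* Generalised for induction: [p] stands for the product of the letters already chosen, and [l]
   letters remain to be chosen. *)
suff /(_ n (leqnn n))[N NP] : forall l, (l <= n)%N -> exists N, forall p s,
    pow_set L (b * (n - l)) p -> (N <= size s)%N ->
    {in s, forall x, pow_set L b x} -> exists t y,
    [/\ subseq t s, size t = l, y \in s &
        pow_set L (2 * l) (p * (\prod_(x <- t) x) * (p * y ^+ l)^-1)].
  exists N => s sizes Ls'.
  have [|t [y [ts tn ys Lt]]] := NP 1 s _ sizes Ls'.
    by rewrite subnn muln0.
  by exists t, y; split=> //; rewrite !mul1g in Lt.
elim=> [|l IH] ln.
  exists 1%N => p [|y s] // _ _ _; exists [::], y; split=> //.
    by rewrite inE eqxx.
  by rewrite big_nil expg0 !mulg1 mulgV; apply/pow_set0.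
have [N NP] := IH (ltnW ln); exists (size F * N).+1 => p s Lp sizes Lbs.
have Lpx x : x \in s -> pow_set L (b * n) (p * x).
  move=> /Lbs Lx; apply: pow_set_le L1 _ (pow_set_mul Lp Lx).
  have -> : (n - l.+1 = n.-1 - l)%N by lia.
  rewrite -mulnSr leq_mul2l; lia.
have [||f Ff] := @count_pigeonhole _ _ (fun x => c (p * x)) F N s => //.
  by move=> x /Lpx/cP[].
rewrite -size_filter; set r := filter _ _ => rN.
have rs : subseq r s by apply: filter_subseq.
have rP x : x \in r -> x \in s /\ L (p * x * f^-1).
  by rewrite mem_filter => /andP[/eqP <- xs]; split=> //; case: (cP _ (Lpx _ xs)).
case: r rN rs rP => [|x r] //= rN rs rP.
have [xs Lxf] : x \in s /\ L (p * x * f^-1) by apply: rP; rewrite inE eqxx.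
have rs' : {in r, forall z, pow_set L b z}.
  by move=> z zr; apply: Lbs; apply: mem_subseq rs _ _; rewrite inE zr orbT.
have [||t [y [tr tl yr Ly]]] := NP (p * x) r _ _ rs' => //.
  have -> : (n - l = (n - l.+1).+1)%N by lia.
  by rewrite mulnSr; apply: pow_set_mul => //; apply: Lbs.
have [ys Lyf] : y \in s /\ L (p * y * f^-1) by apply: rP; rewrite inE yr orbT.
exists (x :: t), y; split=> //=; first by apply: subseq_trans rs; rewrite /= eqxx.
  by rewrite tl.
rewrite big_cons mulgA.
(* Replacing the letter [x] by [y] costs (p x)(p y)^-1, which lies in L^2 because both products have
   the same colour [f]. *)
have -> : p * x * (\prod_(z <- t) z) * (p * y ^+ l.+1)^-1 =
  (p * x * (\prod_(z <- t) z) * (p * x * y ^+ l)^-1) *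
  ((p * x * f^-1) * (p * y * f^-1)^-1).
  by rewrite expgS !invgM !invgK !mulgA !mulgVK.
rewrite mulnS addnC; apply: pow_set_mul => //.
by rewrite -[2%N]/(1 + 1)%N; apply: pow_set_mul; apply/pow_set1 => //; apply: Ls.
Qed.

Variable n : nat.
Hypothesis n_gt0 : (0 < n)%N.
Hypothesis expG : forall g : G, g ^+ n = 1.

(** Induction on the length. A word with at least [N] letters has a subword of length [n] with
    product in L^(2n), because y^n = 1. Moving it to the front conjugates the other letters by
    elements of L^(bn), which the smaller radius b(w - n) for the shorter word allows. Shorter words
    lie in L^(bN). *)
Lemma prod_conj_stable b : exists N, forall w s, size s = w ->
  {in s, forall x, conj_core (pow_set L (b * w)) (pow_set L b) x} ->
  pow_set L (2 * w + b * N) (\prod_(x <- s) x).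
Proof.
have [N NP] := subseq_near_power b n; exists N => w.
elim/ltn_ind: w => w IH s sizes sP.
have Lbs : {in s, forall x, pow_set L b x}.
  by move=> x /sP; apply: conj_core_sub; apply: pow_set_one.
have [ltN|leN] := ltnP w N.
  have := pow_set_prod Lbs; rewrite sizes pow_set_pow.
  by apply: pow_set_le => //; rewrite mulnC; nia.
have [|t [y [ts tn]]] := NP s _ Lbs; first by rewrite sizes.
rewrite expG invg1 mulg1 => Lt.
have [s' [sizes' -> s'P]] := prod_subseq ts.
rewrite sizes tn in sizes'.
have -> : (2 * w + b * N = 2 * n + (2 * (w - n) + b * N))%N by lia.
apply: pow_set_mul => //; apply: IH; [lia|lia|].
move=> _ /s'P[x [u [xs ut ->]]] h Lh.
set q := \prod_(y <- u) y.
have Lq : pow_set L (b * n) q^-1.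
  apply: pow_setV => //.
  apply: (@pow_set_le _ _ (b * size u)) => //.
    by rewrite -tn leq_mul2l size_subseq ?orbT.
  rewrite mulnC -pow_set_pow; apply: pow_set_prod => z zu.
  by apply: Lbs; apply: mem_subseq zu; apply: subseq_trans ts.
have := sP x xs (h * q^-1); rewrite invgM invgK !mulgA; apply.
have -> : (b * w = b * (w - n) + b * n)%N by rewrite -mulnDr; congr muln; lia.
exact: pow_set_mul.
Qed.

Lemma slow_growth C : exists m S,
  [/\ (0 < m)%N, thick L S & pow_set S (C * m) `<=` pow_set L m].
Proof.
(* An element of S^(Cm) = S^(wa) is a word of [w] letters from S^a, and the conjugates of each
   letter by L^(bw) lie in (L^4)^a = L^b. As bN < w, the resulting exponent 2w + bN is at most m =
   3w. *)
pose a := (3 * C)%N; pose b := (a * 4)%N.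
have [N NP] := prod_conj_stable b.
pose w := (b * N).+1; exists (3 * w)%N.
exists (conj_core (pow_set L (b * w)) (pow_set L 4)); split=> //.
  exact: conj_core_thick.
move=> x; have -> : (C * (3 * w) = w * a)%N by rewrite /a; lia.
move=> /pow_set_pow/pow_set_seq[s [sizes sP ->]].
apply: (@pow_set_le _ _ (2 * w + b * N)%N) => //; first by rewrite /w; lia.
apply: NP => // y /sP Sy g Lg; rewrite /b -pow_set_pow.
by apply: pow_set_conj Sy => z; apply.
Qed.

End Collect.

(** * Powers that double at bounded cost stay bounded *)

Section Stabilize.
Variables (G : groupType) (L Q : set G) (c u : nat) (F : seq G).
Hypotheses (L1 : L 1) (Ls : sym_set L) (Q1 : Q 1) (Qs : sym_set Q).
Hypothesis QL : Q `<=` pow_set L c.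
Let V := pow_set L (u + 2 + c).
Hypothesis V_cover : forall x, V x -> exists2 f, f \in F & L (x * f^-1).

Definition separated (ys : seq G) :=
  pairwise (fun y z => `[< ~ pow_set L 2 (y^-1 * z) >]) ys.

(** If y^-1 and z^-1 lie in the same right translate of [L], then y^-1 z is in L^2; so a separated
    list injects into [F]. *)
Lemma separated_size ys : (forall y, y \in ys -> V y) -> separated ys ->
  (size ys <= size F)%N.
Proof.
move=> ysV sep.
have /choice[f fP] : forall y, exists f, V y -> f \in F /\ L (y^-1 * f^-1).
  move=> y; have [/(pow_setV Ls)/V_cover[f Ff Lf]|nV] := pselect (V y).
    by exists f.
  by exists 1.
rewrite -(size_map f ys); apply: uniq_leq_size; last first.
  by move=> z /mapP[y /ysV Vy ->]; case: (fP y Vy).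
elim: ys ysV sep => //= y ys IH ysV /andP[/allP sepy sep].
rewrite IH// => [|z zys]; last by apply: ysV; rewrite inE zys orbT.
rewrite andbT; apply/mapP => -[z zys fyz].
have /asboolP := sepy z zys; apply.
have [_ Ly] := fP _ (ysV y (mem_head _ _)).
have [_ Lz] : f z \in F /\ L (z^-1 * (f z)^-1) by apply/fP/ysV; rewrite inE zys orbT.
rewrite -fyz in Lz; have -> : y^-1 * z = (y^-1 * (f y)^-1) * (z^-1 * (f y)^-1)^-1.
  by rewrite !invgM !invgK !mulgA mulgVK.
by rewrite -[2]/(1 + 1)%N; apply: pow_set_mul; apply/pow_set1 => //; apply: Ls.
Qed.

(** The exponent of [L] that suffices after [i] points are found. A step needs beta + u + 2 for an
    absorbed power, beta for Q^tau and c for one more letter of [Q]. *)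
Definition beta i := iter i (fun b => 2 * b + u + 2 + c)%N c.

Arguments beta : simpl never.

Lemma betaS i : beta i.+1 = (2 * beta i + u + 2 + c)%N.
Proof. by []. Qed.

Lemma beta_le i j : (i <= j)%N -> (beta i <= beta j)%N.
Proof.
move=> /subnK <-; elim: (j - i)%N => // k IH.
by apply: leq_trans IH _; rewrite addSn betaS; lia.
Qed.

Hypothesis doubling : forall tau, (0 < tau)%N ->
  pow_set Q tau `<=` pow_set L (beta (size F)) ->
  pow_set Q (2 * tau) `<=` prod_set (pow_set Q tau) (pow_set L u).

(** Write x' = z w with z in Q^tau and w in L^(u+2). Then w q is a reached point of [V], so it is
    near some y in [ys]; z y lies in Q^(2 tau), and doubling brings it back to Q^tau L^u. The error
    stays in L^(u+2) and does not accumulate with [i]. *)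
Lemma absorb (ys : seq G) tau k : (0 < tau)%N ->
  pow_set Q tau `<=` pow_set L (beta (size F)) ->
  (forall y, y \in ys -> pow_set Q tau y) ->
  (forall i v, (i < k)%N -> pow_set Q i v -> V v ->
    exists2 y, y \in ys & pow_set L 2 (v^-1 * y)) ->
  forall i, (i + tau < k)%N ->
    pow_set Q i `<=` prod_set (pow_set Q tau) (pow_set L (u + 2)).
Proof.
move=> tau0 tauL ysQ near; elim=> [|i IH] ik x.
  move=> /pow_set0 ->; exists 1; first exact: pow_set_one.
  by exists 1; [exact: pow_set_one | rewrite mulg1].
rewrite -addn1 => /pow_set_split[x' [q [Qx' /pow_set1 Qq ->]]].
have [|z Qz [w Lw x'E]] := IH _ _ Qx'; first by lia.
have [|||y yys Ly] := @near (tau + (i + 1))%N (w * q).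
- by lia.
- have -> : w * q = z^-1 * (x' * q) by rewrite -x'E !mulgA mulVg mul1g.
  by apply: pow_set_mul; [exact: pow_setV | apply: pow_set_mul => //; apply/pow_set1].
- by apply: pow_set_mul => //; apply: QL.
have [|z' Qz' [u' Lu' E]] := @doubling tau tau0 tauL (z * y).
  by rewrite mul2n -addnn; apply: pow_set_mul => //; apply: ysQ.
exists z' => //; exists (u' * ((w * q)^-1 * y)^-1).
  by apply: pow_set_mul => //; apply: pow_setV.
by rewrite mulgA E -x'E !invgM !invgK !mulgA mulgK.
Qed.

(* Each new separated point of [V] reached by the powers of [Q] costs one
   roughly two-fold increase of the exponent; there are at most [size F]
   of them. *)
Lemma bounded_powers : exists B, forall i, pow_set Q i `<=` pow_set L B.
Proof.
(* [d] exceeds the number of points that can still be added to [ys]. *)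
suff: forall d ys tau, (size F < size ys + d)%N -> (0 < tau)%N ->
    pow_set Q tau `<=` pow_set L (beta (size ys)) ->
    (forall y, y \in ys -> pow_set Q tau y /\ V y) -> separated ys ->
    exists B, forall i, pow_set Q i `<=` pow_set L B.
  move=> H; apply: (H (size F).+1 [::] 1%N) => //= x /pow_set1; exact: QL.
elim=> [|d IH] ys tau sizeF tau0 tauL ysP sep.
  have : (size ys <= size F)%N by apply: separated_size => // y /ysP[].
  by lia.
have tauL' : pow_set Q tau `<=` pow_set L (beta (size F)).
  have sz : (size ys <= size F)%N by apply: separated_size => // y /ysP[].
  by move=> x /tauL; apply: pow_set_le => //; apply: beta_le.
pose new k := `[< exists v, [/\ pow_set Q k v, V v &
  forall y, y \in ys -> ~ pow_set L 2 (v^-1 * y)] >].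
have near k : (forall i, (i < k)%N -> ~~ new i) -> forall i v, (i < k)%N ->
    pow_set Q i v -> V v -> exists2 y, y \in ys & pow_set L 2 (v^-1 * y).
  move=> nnew i v ik Qv Vv; apply: contrapT => nv.
  have /asboolPn := nnew i ik; apply; exists v; split=> // y yys Ly.
  by apply: nv; exists y.
have ysQ y : y \in ys -> pow_set Q tau y by move=> /ysP[].
have inL k i : (forall i, (i < k)%N -> ~~ new i) -> (i + tau < k)%N ->
    pow_set Q i `<=` pow_set L (beta (size ys) + (u + 2)).
  move=> nnew itk x Qx.
  have [z Qz [w Lw <-]] := absorb tau0 tauL' ysQ (near _ nnew) itk Qx.
  by apply: pow_set_mul => //; apply: tauL.
have [[k newk]|nonew] := pselect (exists k, new k); last first.
  exists (beta (size ys) + (u + 2))%N => i; apply: (inL (i + tau).+1) => // j _.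
  by apply/negP => newj; apply: nonew; exists j.
case: (ex_minnP (ex_intro _ k newk)) => {newk}k /asboolP[v [Qv Vv vys]] kmin.
have sep' : separated (v :: ys).
  by apply/andP; split=> //; apply/allP => y yys; apply/asboolP/vys.
(* If k <= tau, the new point already lies in Q^tau and the exponent is kept; otherwise the exponent
   becomes [k]. *)
have [le_k_tau|lt_tau_k] := leqP k tau.
  apply: (IH (v :: ys) tau) => //=; first by rewrite addSnnS.
    by move=> x /tauL; apply: pow_set_le => //; apply: beta_le.
  move=> y; rewrite inE => /orP[/eqP->|/ysP//].
  by split=> //; apply: pow_set_le le_k_tau _.
apply: (IH (v :: ys) k) => //=; [by rewrite addSnnS | exact: leq_trans lt_tau_k | |].
  (* As [k] is minimal, Q^(k - tau - 1) is absorbed; the rest of the exponent is [tau] plus one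
     letter. *)
  move=> x; have -> : k = (k - tau.+1 + (tau + 1))%N by clear -lt_tau_k; lia.
  move=> /pow_set_split[y [z [Qy /pow_set_split[z1 [q [Qz1 /pow_set1 Qq ->]]] ->]]].
  apply: (@pow_set_le _ _ ((beta (size ys) + (u + 2)) + (beta (size ys) + c))) => //.
    by rewrite betaS; move: (beta (size ys)) => b; clear; lia.
  apply: pow_set_mul; last by apply: pow_set_mul; [exact: tauL | exact: QL].
  apply: (inL k (k - tau.+1)%N) => //; last by clear -lt_tau_k; lia.
  by move=> i ik; apply/negP => /kmin; rewrite leqNgt ik.
move=> y; rewrite inE => /orP[/eqP->//|/ysP[Qy Vy]]; split=> //.
by apply: pow_set_le Qy => //; apply: ltnW.
Qed.

End Stabilize.

Local Open Scope ring_scope.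

(** * Fractional covering numbers *)

Definition ntrue (P : nat -> Prop) N : nat := (\sum_(k < N) `[< P k >])%N.

Lemma ntrue_le P N : (ntrue P N <= N)%N.
Proof.
rewrite -[leqRHS]card_ord -sum1_card; apply: leq_sum => k _; exact: leq_b1.
Qed.

Lemma ntrue_all (P : nat -> Prop) N : (forall k, (k < N)%N -> P k) -> ntrue P N = N.
Proof.
move=> HP; rewrite -[RHS]card_ord -sum1_card; apply: eq_bigr => k _.
by rewrite asboolT//; apply: HP.
Qed.

Lemma ntrue_eq0 (P : nat -> Prop) N : (forall k, (k < N)%N -> ~ P k) -> ntrue P N = 0%N.
Proof. by move=> HP; apply: big1 => k _; rewrite asboolF//; apply: HP. Qed.

(** Only indices k with k + d >= N can be lost, at most [d] of them. *)
Lemma ntrue_shift (P P' : nat -> Prop) N d :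
  (forall k, (k < N)%N -> P k -> P' (k + d)%N) -> (ntrue P N <= ntrue P' N + d)%N.
Proof.
move=> PP'; apply: (@leq_trans (ntrue P' (d + N))).
  rewrite /ntrue big_split_ord /=; apply: leq_trans (leq_addl _ _).
  apply: leq_sum => k _; have [/(PP' _ (ltn_ord k)) Pk|//] := asboolP (P k).
  by rewrite asboolT// addnC.
rewrite addnC {1}/ntrue big_split_ord /= leq_add2l.
rewrite -[leqRHS]card_ord -sum1_card; apply: leq_sum => k _; exact: leq_b1.
Qed.

Section FractionalCover.
Variables (R : realType) (G : groupType) (S : set G).
Implicit Types (F H : G -> R) (s : seq (R * G)) (A B : set G).

Definition ind A (z : G) : R := (`[< A z >])%:R.

Definition fcover F s := (forall p, p \in s -> 0 <= p.1) /\
  forall z, F z <= \sum_(p <- s) p.1 * ind S (p.2^-1 * z)%g.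

Definition coverable F := exists s, fcover F s.

(** Haar's covering ratio of [F] by the indicator of [S]: a left-invariant, subadditive substitute
    for the integral, meaningful for [coverable] functions. *)
Definition covnum F := inf [set \sum_(p <- s) p.1 | s in fcover F].

Lemma ind_ge0 A z : 0 <= ind A z.
Proof. exact: ler0n. Qed.

Lemma ind_le1 A z : ind A z <= 1.
Proof. by rewrite /ind; case: asboolP. Qed.

Lemma indT (A : set G) z : A z -> ind A z = 1.
Proof. by move=> Az; rewrite /ind asboolT. Qed.

Lemma indF (A : set G) z : ~ A z -> ind A z = 0.
Proof. by move=> Az; rewrite /ind asboolF. Qed.

Lemma ind_sub A B z : A `<=` B -> ind A z <= ind B z.
Proof.
move=> AB; have [/[dup] Az /AB Bz|nAz] := pselect (A z); first by rewrite !indT.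
by rewrite (indF nAz) ind_ge0.
Qed.

Lemma fcover_weight_ge0 F s : fcover F s -> 0 <= \sum_(p <- s) p.1.
Proof. by move=> [s0 _]; rewrite big_seq sumr_ge0// => p /s0. Qed.

Lemma covnum_lbound F : has_lbound [set \sum_(p <- s) p.1 | s in fcover F].
Proof. by exists 0 => _ [s /fcover_weight_ge0 ? <-]. Qed.

Lemma covnum_le F s : fcover F s -> covnum F <= \sum_(p <- s) p.1.
Proof. by move=> Fs; apply: (ge_inf (covnum_lbound F)); exists s. Qed.

Lemma le_covnum F (r : R) : coverable F ->
  (forall s, fcover F s -> r <= \sum_(p <- s) p.1) -> r <= covnum F.
Proof.
move=> [s Fs] rF; apply: lb_le_inf; first by exists (\sum_(p <- s) p.1), s.
by move=> _ [t Ft <-]; apply: rF.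
Qed.

Lemma covnum_mono F H : coverable H -> (forall z, F z <= H z) ->
  covnum F <= covnum H.
Proof.
move=> cH FH; apply: le_covnum => // s [s0 Hs]; apply: covnum_le; split=> // z.
exact: le_trans (FH z) (Hs z).
Qed.

Lemma coverable_mono F H : coverable H -> (forall z, F z <= H z) -> coverable F.
Proof.
by move=> [s [s0 Hs]] FH; exists s; split=> // z; apply: le_trans (FH z) (Hs z).
Qed.

Lemma fcover_cat F H s t : fcover F s -> fcover H t ->
  fcover (fun z => F z + H z) (s ++ t).
Proof.
move=> [s0 Fs] [t0 Ht]; split=> [p|z].
  by rewrite mem_cat => /orP[/s0|/t0].
by rewrite big_cat lerD.
Qed.

Lemma coverableD F H : coverable F -> coverable H ->
  coverable (fun z => F z + H z).
Proof. by move=> [s Fs] [t Ht]; exists (s ++ t); apply: fcover_cat. Qed.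

Lemma covnumD F H : coverable F -> coverable H ->
  covnum (fun z => F z + H z) <= covnum F + covnum H.
Proof.
move=> cF cH; rewrite -lerBlDr; apply: le_covnum => // s Fs.
rewrite lerBlDr addrC -lerBlDr; apply: le_covnum => // t Ht.
by rewrite lerBlDr addrC -big_cat; apply: covnum_le; apply: fcover_cat.
Qed.

Lemma fcoverZ F s (c : R) : 0 <= c -> fcover F s ->
  fcover (fun z => c * F z) [seq (c * p.1, p.2) | p <- s].
Proof.
move=> c0 [s0 Fs]; split=> [_ /mapP[p /s0 p0 ->]|z]; first exact: mulr_ge0.
rewrite big_map /=; under eq_bigr do rewrite -mulrA.
by rewrite -mulr_sumr ler_wpM2l.
Qed.

Lemma coverableZ F (c : R) : 0 <= c -> coverable F -> coverable (fun z => c * F z).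
Proof. by move=> c0 [s Fs]; exists [seq (c * p.1, p.2) | p <- s]; apply: fcoverZ. Qed.

Lemma covnumZ_le F (c : R) : 0 < c -> coverable F ->
  covnum (fun z => c * F z) <= c * covnum F.
Proof.
move=> c0 cF; rewrite -ler_pdivrMl//; apply: le_covnum => // s Fs.
rewrite ler_pdivrMl// mulr_sumr.
by have := covnum_le (fcoverZ (ltW c0) Fs); rewrite big_map.
Qed.

Lemma covnumZ F (c : R) : 0 < c -> coverable F ->
  covnum (fun z => c * F z) = c * covnum F.
Proof.
move=> c0 cF; apply/eqP; rewrite eq_le covnumZ_le//=.
rewrite -ler_pdivlMl//.
have := @covnumZ_le (fun z => c * F z) c^-1.
rewrite invr_gt0 => /(_ c0 (coverableZ (ltW c0) cF)).
by under eq_fun do rewrite mulrA mulVf ?gt_eqF// mul1r.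
Qed.

Lemma fcover_translate F s g : fcover F s ->
  fcover (fun z => F (g * z)%g) [seq (p.1, (g^-1 * p.2)%g) | p <- s].
Proof.
move=> [s0 Fs]; split=> [_ /mapP[p /s0 p0 ->]//|z].
by rewrite big_map /=; under eq_bigr do rewrite invgM invgK -mulgA.
Qed.

Lemma coverable_translate F g : coverable F -> coverable (fun z => F (g * z)%g).
Proof. by move=> [s /(fcover_translate g) Fs]; exists [seq (p.1, (g^-1 * p.2)%g) | p <- s]. Qed.

Lemma covnum_translate F g : coverable F -> covnum (fun z => F (g * z)%g) = covnum F.
Proof.
move=> cF.
have le_tr H h : coverable H -> covnum (fun z => H (h * z)%g) <= covnum H.
  move=> cH; apply: le_covnum => // s Hs.
  by have := covnum_le (fcover_translate h Hs); rewrite big_map.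
apply/eqP; rewrite eq_le le_tr//=.
have := le_tr _ g^-1%g (coverable_translate g cF).
by under eq_fun do rewrite mulVKg.
Qed.

Lemma covnum_ind_ge1 A : A !=set0 -> coverable (ind A) -> 1 <= covnum (ind A).
Proof.
move=> [a Aa] cA; apply: le_covnum => // s [s0 /(_ a)]; rewrite indT// => /le_trans; apply.
rewrite big_seq [leRHS]big_seq; apply: ler_sum => p /s0 p0.
by rewrite ler_piMr// ind_le1.
Qed.

(* The covering number is only subadditive, but it is almost additive on a
   function split by a weight which varies little on each translate of [S]. *)
Lemma covnum_split F (h : G -> R) (d : R) : coverable F -> 0 <= d ->
  (forall z, 0 <= h z <= 1) ->
  (forall g z, S z -> `|h (g * z)%g - h g| <= d) ->
  covnum (fun z => h z * F z) + covnum (fun z => (1 - h z) * F z) <=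
    (1 + 2 * d) * covnum F.
Proof.
move=> cF d0 h01 hd; rewrite -ler_pdivrMl; last by lra.
apply: le_covnum => // s [s0 Fs]; rewrite ler_pdivrMl; last by lra.
(* On the translate centred at [p.2] the function [k] is at most [k p.2 + d], so a cover of [F] with
   weights scaled by this factor covers the product. For [h] and [1 - h] the two factors add up to 1
   + 2d. *)
have bound (k : G -> R) : (forall z, 0 <= k z) ->
    (forall g z, S z -> `|k (g * z)%g - k g| <= d) ->
    covnum (fun z => k z * F z) <= \sum_(p <- s) (k p.2 + d) * p.1.
  move=> k0 kd; rewrite -(big_map (fun p => ((k p.2 + d) * p.1, p.2)) predT fst).
  apply: covnum_le; split=> [_ /mapP[p /s0 p0 ->] /=|z].
    by rewrite mulr_ge0// addr_ge0.
  apply: le_trans (ler_wpM2l (k0 z) (Fs z)) _.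
  rewrite mulr_sumr big_map big_seq [leRHS]big_seq; apply: ler_sum => p /s0 p0 /=.
  have [Sz|nSz] := pselect (S (p.2^-1 * z)%g); last by rewrite indF// !mulr0.
  rewrite indT// !mulr1; have := kd p.2 _ Sz; rewrite mulVKg ler_norml => /andP[_ kz].
  by rewrite ler_wpM2r//; lra.
apply: le_trans (lerD (bound h _ hd) (bound (fun z => 1 - h z) _ _)) _.
- by move=> z; case/andP: (h01 z).
- by move=> z; case/andP: (h01 z) => _; rewrite subr_ge0.
- move=> g z Sz; rewrite -normrN.
  have -> : - (1 - h (g * z)%g - (1 - h g)) = h (g * z)%g - h g by ring.
  exact: hd.
rewrite -big_split mulr_sumr /=; apply: ler_sum => p _.
by rewrite -mulrDl le_eqVlt; apply/orP; left; apply/eqP; congr (_ * _); ring.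
Qed.

End FractionalCover.

(** * Doubling the exponent *)

Lemma dist_natrM (R : realType) (a b d N : nat) :
  (a <= b + d)%N -> (b <= a + d)%N ->
  `|a%:R / N%:R - b%:R / N%:R| <= d%:R / N%:R :> R.
Proof.
move=> ab ba; rewrite -mulrBl normrM [`|N%:R^-1|]ger0_norm ?invr_ge0//.
rewrite ler_wpM2r ?invr_ge0// ler_norml.
by rewrite lerBlDr -natrD lerNl opprB lerBlDr -natrD !ler_nat addnC ba addnC ab.
Qed.

Section Gleason.
Variables (R : realType) (G : groupType) (n : nat).
Hypothesis n_gt0 : (0 < n)%N.
Hypothesis expG : forall g : G, (g ^+ n = 1)%g.

Variables (A E S T W : set G) (N tau : nat).
Let A' := prod_set A (pow_set E N).
Let K := (N * tau)%N.

Hypothesis N_large : (300 <= N)%N.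
Hypothesis tau_gt0 : (0 < tau)%N.
Hypothesis A_neq0 : A !=set0.
Hypotheses (E1 : E 1%g) (E_sym : sym_set E).
Hypotheses (S1 : S 1%g) (S_sym : sym_set S) (T_sym : sym_set T).
Hypothesis T_conj : forall a t, A a -> T t -> S (a * t * a^-1)%g.
Hypothesis E_conj : forall q i x a, pow_set S N q -> (i < n)%N -> W x -> A' a ->
  E ((x * a)^-1 * q ^+ i * (x * a))%g.
Hypothesis W_reach : forall z a,
  prod_set (pow_set S K) A z -> A' a -> W (z * a^-1)%g.
Hypothesis A'_cover : coverable T (@ind R G A').
Hypothesis A'_growth : 2 * covnum T (@ind R G A') <= 3 * covnum T (@ind R G A).

(* Ramps obtained by averaging over [k]: [psi] descends from 1 on [A] to 0
   outside [S^K A] in small steps under left multiplication by [S^N] and in tiny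
   ones under right multiplication by [T]; [theta x] descends from 1 on [x A] to
   0 outside [x A']. *)
Definition psi (z : G) : R :=
  (ntrue (fun k => prod_set (pow_set S k) A z) K)%:R / K%:R.

Definition theta (x z : G) : R :=
  (ntrue (fun k => prod_set A (pow_set E k) (x^-1 * z)%g) N)%:R / N%:R.

Let N_gt0 : (0 < N)%N. Proof. exact: leq_trans N_large. Qed.

Let K_gt0 : (0 < K)%N. Proof. by rewrite muln_gt0 N_gt0. Qed.

Let K_gt0R : 0 < K%:R :> R. Proof. by rewrite ltr0n. Qed.

Let SA_le i j z : (i <= j)%N ->
  prod_set (pow_set S i) A z -> prod_set (pow_set S j) A z.
Proof.
move=> ij [s Ss [a Aa <-]]; exists s; first exact: pow_set_le Ss.
by exists a.
Qed.

Let AE_le i j z : (i <= j)%N ->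
  prod_set A (pow_set E i) z -> prod_set A (pow_set E j) z.
Proof.
move=> ij [a Aa [e Ee <-]]; exists a => //; exists e => //.
exact: pow_set_le Ee.
Qed.

Let AA' : A `<=` A'.
Proof. by move=> a Aa; exists a => //; exists 1%g; rewrite ?mulg1//; apply: pow_set_one. Qed.

Let ratio01 a b : (a <= b)%N -> 0 <= (a%:R / b%:R : R) <= 1.
Proof.
move=> ab; rewrite divr_ge0//=; case: b ab => [|b] ab.
  by rewrite invr0 mulr0.
by rewrite ler_pdivrMr ?ltr0n// mul1r ler_nat.
Qed.

Lemma psi01 z : 0 <= psi z <= 1.
Proof. exact/ratio01/ntrue_le. Qed.

Lemma theta01 x z : 0 <= theta x z <= 1.
Proof. exact/ratio01/ntrue_le. Qed.

Lemma psi_eq1 z : A z -> psi z = 1.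
Proof.
move=> Az; rewrite /psi ntrue_all ?divff ?gt_eqF// => k _.
by exists 1%g; [exact: pow_set_one | exists z; rewrite ?mul1g].
Qed.

Lemma theta_eq1 z : A z -> theta 1%g z = 1.
Proof.
move=> Az; rewrite /theta ntrue_all ?divff ?gt_eqF ?ltr0n// => k _.
by exists z; rewrite ?invg1 ?mul1g//; exists 1%g; [exact: pow_set_one | rewrite mulg1].
Qed.

Lemma theta_out x z : ~ A' (x^-1 * z)%g -> theta x z = 0.
Proof.
move=> nA'; rewrite /theta ntrue_eq0 ?mul0r// => k kN /(AE_le (ltnW kN)).
exact: nA'.
Qed.

Lemma psi_out z : ~ prod_set (pow_set S K) A z -> psi z = 0.
Proof.
move=> nSA; rewrite /psi ntrue_eq0 ?mul0r// => k kN /(SA_le (ltnW kN)).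
exact: nSA.
Qed.

Lemma theta_translate g x z : theta (g * x)%g (g * z)%g = theta x z.
Proof. by rewrite /theta invgM -mulgA mulKg. Qed.

(** Since s a t = s (a t a^-1) a with a t a^-1 in [S], a right factor from [T] raises the level by
    at most one. *)
Lemma psi_right z t : T t -> `|psi (z * t)%g - psi z| <= K%:R^-1.
Proof.
have step y u k : T u -> prod_set (pow_set S k) A y ->
    prod_set (pow_set S (k + 1)) A (y * u)%g.
  move=> Tu [s Ss [a Aa <-]]; exists (s * (a * u * a^-1))%g.
    by apply: pow_set_mul => //; apply/pow_set1; apply: T_conj.
  by exists a; rewrite // !mulgA mulgVK.
move=> Tt; rewrite -[leRHS]mul1r -[1]/(1%:R).
apply: dist_natrM; apply: ntrue_shift => k _ SA; last exact: step.
by rewrite -[z](mulgK t); apply: step => //; apply: T_sym.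
Qed.

Lemma psi_left q z : pow_set S N q -> `|psi (q * z)%g - psi z| <= tau%:R^-1.
Proof.
have step p y k : pow_set S N p -> prod_set (pow_set S k) A y ->
    prod_set (pow_set S (k + N)) A (p * y)%g.
  move=> Sp [s Ss [a Aa <-]]; exists (p * s)%g.
    by rewrite addnC; apply: pow_set_mul.
  by exists a; rewrite ?mulgA.
move=> Sq; have -> : tau%:R^-1 = N%:R / K%:R :> R.
  by rewrite /K natrM invfM mulrA divff ?mul1r// pnatr_eq0 -lt0n.
apply: dist_natrM; apply: ntrue_shift => k _ SA; last exact: step.
by rewrite -[z](mulKg q); apply: step => //; apply: pow_setV.
Qed.

(** With p = q^i, p x a = x a ((x a)^-1 p (x a)) and the conjugate lies in [E], so levels shift by
    at most one. The indicators record that both functions vanish off the two translates of [A']. *)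
Lemma theta_left q i x z : pow_set S N q -> (i < n)%N -> W x ->
  `|theta (q ^+ i * x)%g z - theta x z| <=
    N%:R^-1 * (ind R A' (x^-1 * z)%g + ind R A' ((q ^+ i * x)^-1 * z)%g).
Proof.
move=> Sq lt_in Wx; set p := (q ^+ i)%g.
have Ep a : A' a -> E ((x * a)^-1 * p * (x * a))%g by move=> A'a; apply: E_conj.
have [A'a|nA'a] := pselect (A' (x^-1 * z)%g); last first.
  have [A'b|nA'b] := pselect (A' ((p * x)^-1 * z)%g); last first.
    rewrite (theta_out nA'a) (theta_out nA'b) subr0 normr0.
    by rewrite mulr_ge0 ?invr_ge0// addr_ge0// ind_ge0.
  rewrite (indF R nA'a) (indT R A'b) add0r mulr1 -[leRHS]mul1r -[1]/(1%:R).
  apply: dist_natrM; apply: ntrue_shift => k kN; last first.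
    by move=> /(AE_le (ltnW kN))/nA'a.
  move=> [a Aa [e Ee zE]].
  have A'ae : A' (a * e)%g.
    by apply: (AE_le (ltnW kN)); exists a => //; exists e.
  exists a => //; exists (e * ((x * (a * e))^-1 * p * (x * (a * e))))%g.
    by apply: pow_set_mul => //; apply/pow_set1; apply: Ep.
  have -> : z = (p * x * (a * e))%g by rewrite zE mulVKg.
  by rewrite !invgM !mulgA mulgK mulgV mul1g.
apply: (@le_trans _ _ N%:R^-1); last first.
  rewrite -[leLHS]mulr1 ler_wpM2l ?invr_ge0// (indT R A'a) lerDl ind_ge0//.
have zE : z = (x * (x^-1 * z))%g by rewrite mulVKg.
rewrite -[leRHS]mul1r -[1]/(1%:R).
apply: dist_natrM; apply: ntrue_shift => k kN [a Aa [e Ee aeE]].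
  have A'ae : A' (a * e)%g.
    by apply: (AE_le (ltnW kN)); exists a => //; exists e.
  exists a => //; exists (e * ((x * (a * e))^-1 * p * (x * (a * e))))%g.
    by apply: pow_set_mul => //; apply/pow_set1; apply: Ep.
  have -> : z = (p * x * (a * e))%g by rewrite aeE mulVKg.
  by rewrite !invgM !mulgA mulgK mulgV mul1g.
have A'ae : A' (a * e)%g.
  by apply: (AE_le (ltnW kN)); exists a => //; exists e.
exists a => //; exists (e * ((x * (a * e))^-1 * p * (x * (a * e)))^-1)%g.
  by apply: pow_set_mul => //; apply/pow_set1; apply: E_sym; apply: Ep.
have -> : z = (x * (a * e))%g by rewrite aeE mulVKg.
by rewrite !invgM !invgK !mulgA mulgK mulgV mul1g.
Qed.

Let c : R := tau%:R^-1.
Let v0 := covnum T (theta 1%g).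
Let v1 := covnum T (@ind R G A').

Let c_gt0 : 0 < c. Proof. by rewrite invr_gt0 ltr0n. Qed.

Let c_le1 : c <= 1. Proof. by rewrite invf_le1 ?ltr0n// ler1n. Qed.

Lemma theta_cover x : coverable T (theta x).
Proof.
apply: coverable_mono (coverable_translate x^-1%g A'_cover) _ => z.
have [A'z|nA'z] := pselect (A' (x^-1 * z)%g).
  by rewrite indT//; case/andP: (theta01 x z).
by rewrite theta_out// ind_ge0.
Qed.

Lemma covnum_theta x : covnum T (theta x) = v0.
Proof.
rewrite /v0 -(covnum_translate x^-1%g (theta_cover 1%g)).
by congr covnum; apply: funext => z; rewrite -(theta_translate x^-1%g x z) mulVg.
Qed.

Lemma covnum_theta_le : v0 <= v1.
Proof.
apply: covnum_mono => // z; have [A'z|nA'z] := pselect (A' z).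
  by rewrite indT//; case/andP: (theta01 1%g z).
by rewrite theta_out ?ind_ge0// invg1 mul1g.
Qed.

Lemma mul_theta_cover (f : G -> R) x : (forall z, f z <= 2) ->
  coverable T (fun z => f z * theta x z).
Proof.
move=> f2; apply: coverable_mono (coverableZ (ler0n R 2) (theta_cover x)) _ => z.
by rewrite ler_wpM2r//; case/andP: (theta01 x z).
Qed.

(** Split s theta, with s = f + g, by the weight f/s. As s >= 1, this weight varies by at most 2/K
    on translates of [T]; the covering number of s theta is at most 2 v0, so the error is 2 (2/K) (2
    v0). *)
Lemma covnum_almost_additive (f g : G -> R) x :
  (forall z, 0 <= f z) -> (forall z, 0 <= g z) ->
  (forall z, 1 <= f z + g z <= 2) ->
  (forall z t, T t -> `|f (z * t)%g - f z| <= K%:R^-1) ->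
  (forall z t, T t -> `|(f (z * t)%g + g (z * t)%g) - (f z + g z)| <= K%:R^-1) ->
  covnum T (fun z => f z * theta x z) + covnum T (fun z => g z * theta x z) <=
    covnum T (fun z => (f z + g z) * theta x z) + 8 * v0 / K%:R.
Proof.
move=> f0 g0 fg12 fT fgT; pose s z := f z + g z.
have s_gt0 z : 0 < s z by case/andP: (fg12 z) => + _; exact: lt_le_trans.
have s_ge1 z : 1 <= s z by case/andP: (fg12 z).
have cs : coverable T (fun z => s z * theta x z).
  by apply: mul_theta_cover => z; case/andP: (fg12 z).
have Ki_ge0 : 0 <= K%:R^-1 :> R by rewrite invr_ge0.
have := @covnum_split R G T (fun z => s z * theta x z) (fun z => f z / s z)
  (2 * K%:R^-1) cs.
have -> : (fun z => f z / s z * (s z * theta x z)) = (fun z => f z * theta x z).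
  by apply: funext => z; rewrite mulrA divfK// gt_eqF.
have -> : (fun z => (1 - f z / s z) * (s z * theta x z)) = (fun z => g z * theta x z).
  apply: funext => z; rewrite mulrA mulrBl mul1r divfK ?gt_eqF// /s; ring.
move=> split; apply: (le_trans (split _ _ _)).
- exact: mulr_ge0.
- move=> z; apply/andP; split; first by rewrite divr_ge0 ?(ltW (s_gt0 z)).
  by rewrite ler_pdivrMr// mul1r /s lerDl.
- move=> z t Tt.
  have -> : f (z * t)%g / s (z * t)%g - f z / s z =
      ((f (z * t)%g - f z) - (f z / s z) * (s (z * t)%g - s z)) / s (z * t)%g.
    by field; rewrite !gt_eqF.
  rewrite normrM [X in _ * X]ger0_norm; last by rewrite invr_ge0 ltW.
  rewrite ler_pdivrMr//; apply: (le_trans (ler_normB _ _)).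
  apply: (@le_trans _ _ (2 * K%:R^-1)); last by rewrite ler_peMr// mulr_ge0.
  rewrite mulr2n mulrDl mul1r; apply: lerD; first exact: fT.
  rewrite normrM; apply: le_trans (fgT z t Tt).
  rewrite ler_piMl// ger0_norm; last by rewrite divr_ge0// ltW.
  by rewrite ler_pdivrMr// mul1r /s lerDl.
have Js : covnum T (fun z => s z * theta x z) <= 2 * v0.
  rewrite -(covnum_theta x) -covnumZ//; last exact: theta_cover.
  apply: covnum_mono; first by apply: coverableZ => //; exact: theta_cover.
  move=> z; rewrite ler_wpM2r//; first by case/andP: (theta01 x z).
  by case/andP: (fg12 z).
rewrite mulrDl mul1r lerD2l.
have -> : 8 * v0 / K%:R = 2 * (2 / K%:R) * (2 * v0) by ring.
by rewrite ler_wpM2l// mulr_ge0// mulr_ge0.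
Qed.

Definition phi x := covnum T (fun z => (1 + psi z) * theta x z).

Let one_psi2 z : 1 + psi z <= 2.
Proof. by case/andP: (psi01 z); lra. Qed.

Lemma phi_translate q x :
  phi (q * x)%g = covnum T (fun z => (1 + psi (q * z)%g) * theta x z).
Proof.
rewrite /phi -(covnum_translate q); last exact: mul_theta_cover.
by congr covnum; apply: funext => z; rewrite theta_translate.
Qed.

(** Adding c = 1/tau makes the increment of [psi] nonnegative, as almost additivity requires. *)
Let u q z := psi (q * z)%g - psi z + c.

Lemma u_bound q z : pow_set S N q -> 0 <= u q z <= 2 * c.
Proof. by move=> /(psi_left z); rewrite -/c ler_norml /u => /andP[? ?]; apply/andP; split; lra. Qed.

(** With b = 1 + psi - c, the two values of [phi] belong to the weights b + u and b + c. Almost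
    additivity applies to both, and the common term of b cancels. *)
Lemma phi_increment q x : pow_set S N q ->
  `|phi (q * x)%g - phi x - (covnum T (fun z => u q z * theta x z) - c * v0)|
    <= 8 * v0 / K%:R.
Proof.
move=> Sq; rewrite phi_translate /phi.
pose b z := 1 + psi z - c.
have b0 z : 0 <= b z by case/andP: (psi01 z); rewrite /b; have := c_le1; lra.
have b2 z : b z <= 2 by case/andP: (psi01 z); rewrite /b; have := c_gt0; lra.
have bT z t : T t -> `|b (z * t)%g - b z| <= K%:R^-1.
  move=> Tt; have -> : b (z * t)%g - b z = psi (z * t)%g - psi z by rewrite /b; ring.
  exact: psi_right.
have u0 z : 0 <= u q z by case/andP: (u_bound z Sq).
have u2 z : u q z <= 2 by case/andP: (u_bound z Sq); have := c_le1; lra.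
have eX : (fun z => (1 + psi (q * z)%g) * theta x z) =
    (fun z => (b z + u q z) * theta x z).
  by apply: funext => z; congr (_ * _); rewrite /b /u; ring.
have eY : (fun z => (1 + psi z) * theta x z) = (fun z => (b z + c) * theta x z).
  by apply: funext => z; congr (_ * _); rewrite /b; ring.
have X1 := covnumD (mul_theta_cover x b2) (mul_theta_cover x u2).
have c2 : c <= 2 by have := c_le1; lra.
have Y1 := covnumD (mul_theta_cover x b2) (@mul_theta_cover (fun=> c) x (fun=> c2)).
have X2 := @covnum_almost_additive b (u q) x b0 u0.
have Y2 := @covnum_almost_additive b (fun=> c) x b0 (fun=> ltW c_gt0).
have {}X2 : covnum T (fun z => b z * theta x z) + covnum T (fun z => u q z * theta x z)
    <= covnum T (fun z => (b z + u q z) * theta x z) + 8 * v0 / K%:R.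
  apply: X2 => // [z|z t Tt].
    have -> : b z + u q z = 1 + psi (q * z)%g by rewrite /b /u; ring.
    by case/andP: (psi01 (q * z)%g) => ? ?; apply/andP; split; lra.
  have -> : b (z * t)%g + u q (z * t)%g - (b z + u q z) =
      psi (q * z * t)%g - psi (q * z)%g by rewrite /b /u -mulgA; ring.
  exact: psi_right.
have {}Y2 : covnum T (fun z => b z * theta x z) + covnum T (fun z => c * theta x z)
    <= covnum T (fun z => (b z + c) * theta x z) + 8 * v0 / K%:R.
  apply: Y2 => // [z|z t Tt].
    have -> : b z + c = 1 + psi z by rewrite /b; ring.
    by case/andP: (psi01 z) => ? ?; apply/andP; split; lra.
  have -> : b (z * t)%g + c - (b z + c) = psi (z * t)%g - psi z by rewrite /b; ring.
  exact: psi_right.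
have cY : covnum T (fun z => c * theta x z) = c * v0.
  by rewrite covnumZ ?covnum_theta//; exact: theta_cover.
have D (f : G -> R) : (fun z => b z * theta x z + f z * theta x z) =
    (fun z => (b z + f z) * theta x z).
  by apply: funext => z; rewrite -mulrDl.
move: X1 X2 Y1 Y2; rewrite D (D (fun=> c)) cY eX eY ler_norml => X1 X2 Y1 Y2.
by apply/andP; split; move: X1 X2 Y1 Y2;
  set j1 := covnum T _; set j2 := covnum T _; set j3 := covnum T _;
  set j4 := covnum T _; set k := _ / K%:R; lra.
Qed.

(** [u] is at most 2/tau and [theta] changes by at most 1/N on each of two translates of [A']; with
    K = N tau, the total is 2 (2/K) v1. *)
Lemma u_theta_stable q i x : pow_set S N q -> (i < n)%N -> W x ->
  `|covnum T (fun z => u q z * theta (q ^+ i * x)%g z) -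
    covnum T (fun z => u q z * theta x z)| <= 4 * v1 / K%:R.
Proof.
move=> Sq lt_in Wx; set y := (q ^+ i * x)%g.
have u0 z : 0 <= u q z by case/andP: (u_bound z Sq).
have u2 z : u q z <= 2 by case/andP: (u_bound z Sq); have := c_le1; lra.
pose w z := 2 / K%:R * (ind R A' (x^-1 * z)%g + ind R A' (y^-1 * z)%g).
have dw z : `|u q z * theta y z - u q z * theta x z| <= w z.
  rewrite -mulrBr normrM ger0_norm//.
  have := theta_left z Sq lt_in Wx; rewrite -/y => le_th.
  apply: (le_trans (ler_pM (u0 z) (normr_ge0 _) (proj2 (andP (u_bound z Sq))) le_th)).
  by rewrite le_eqVlt; apply/orP; left; apply/eqP; rewrite /w /K natrM invfM /c; ring.
have cx := coverable_translate x^-1%g A'_cover.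
have cy := coverable_translate y^-1%g A'_cover.
have K0 : 0 < 2 / K%:R :> R by rewrite divr_gt0.
have cw : coverable T w by apply: coverableZ; [exact: ltW | exact: coverableD].
have Jw : covnum T w <= 4 * v1 / K%:R.
  rewrite covnumZ//; last exact: coverableD.
  have -> : 4 * v1 / K%:R = 2 / K%:R * (v1 + v1) by ring.
  rewrite ler_wpM2l ?(ltW K0)//; apply: le_trans (covnumD cx cy) _.
  by rewrite !covnum_translate.
have half f g : coverable T g -> (forall z, `|f z - g z| <= w z) ->
    covnum T f <= covnum T g + 4 * v1 / K%:R.
  move=> cg fgw; apply: (@le_trans _ _ (covnum T (fun z => g z + w z))).
    apply: covnum_mono; first exact: coverableD.
    by move=> z; have := fgw z; rewrite ler_norml => /andP[_]; lra.
  by apply: le_trans (covnumD cg cw) _; rewrite lerD2l.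
have h1 := half _ _ (mul_theta_cover x u2) dw.
have h2 : covnum T (fun z => u q z * theta x z) <=
    covnum T (fun z => u q z * theta y z) + 4 * v1 / K%:R.
  by apply: half (mul_theta_cover y u2) _ => z; rewrite distrC.
by rewrite ler_norml; apply/andP; split; move: h1 h2;
  set j1 := covnum T _; set j2 := covnum T _; set k := _ / K%:R; lra.
Qed.

(* The increments of [phi] along the orbit of [x] under [q] almost coincide,
   and they add up to zero because [q ^+ n = 1]. *)
Lemma phi_lipschitz q x : pow_set S N q -> W x ->
  `|phi (q * x)%g - phi x| <= 20 * v1 / K%:R.
Proof.
move=> Sq Wx; pose D i := phi (q * (q ^+ i * x))%g - phi (q ^+ i * x)%g.
have D0 : \sum_(0 <= i < n) D i = 0.
  under eq_bigr do rewrite /D mulgA -expgS.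
  rewrite (telescope_sumr (fun i => phi (q ^+ i * x)%g))//.
  by rewrite expG expg0 subrr.
(* Two increments contribute 8 each, and the change of the [u] term contributes 4. *)
have DD i : (i < n)%N -> `|D 0%N - D i| <= 20 * v1 / K%:R.
  move=> lt_in; rewrite /D expg0 mul1g.
  have := phi_increment x Sq; have := phi_increment (q ^+ i * x)%g Sq.
  have := u_theta_stable Sq lt_in Wx.
  have : 8 * v0 / K%:R <= 8 * v1 / K%:R.
    by rewrite ler_wpM2r ?invr_ge0// ler_wpM2l// covnum_theta_le.
  have -> : 20 * v1 / K%:R = 8 * v1 / K%:R + 8 * v1 / K%:R + 4 * v1 / K%:R by ring.
  rewrite !ler_norml; set k0 := 8 * v0 / _; set k1 := 8 * v1 / _; set k2 := 4 * v1 / _.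
  set j0 := covnum T _; set j1 := covnum T _.
  set f0 := phi _; set f1 := phi x; set f2 := phi _; set f3 := phi _.
  by move=> H /andP[H1 H2] /andP[H3 H4] /andP[H5 H6]; apply/andP; split; lra.
have n0 : 0 < n%:R :> R by rewrite ltr0n.
have : n%:R * `|D 0%N| <= n%:R * (20 * v1 / K%:R).
  have -> : n%:R * `|D 0%N| = `|\sum_(0 <= i < n) (D 0%N - D i)|.
    rewrite sumrB D0 subr0 sumr_const_nat subn0.
    by rewrite normrMn mulr_natl.
  apply: le_trans (ler_norm_sum _ _ _) _.
  rewrite big_nat; apply: le_trans (ler_sum _ _) _ => [i /andP[_]|]; first exact: DD.
  by rewrite -big_nat /= sumr_const_nat subn0 [leRHS]mulr_natl.
by rewrite ler_pM2l// /D expg0 mul1g.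
Qed.

(** If [psi] vanished wherever [theta x] does not, [phi x] would equal v0; a common point z gives a
    = x^-1 z. *)
Lemma reach_of_phi x : v0 < phi x ->
  exists z a, [/\ prod_set (pow_set S K) A z, A' a & x = (z * a^-1)%g].
Proof.
move=> lt_v0; apply: contrapT => nx; suff phix : phi x = v0.
  by rewrite phix ltxx in lt_v0.
rewrite -(covnum_theta x); congr covnum; apply: funext => z.
have [A'z|/theta_out ->] := pselect (A' (x^-1 * z)%g); last by rewrite mulr0.
rewrite psi_out ?addr0 ?mul1r// => SAz; apply: nx.
by exists z, (x^-1 * z)%g; rewrite invgM invgK mulVKg.
Qed.

Lemma gleason_step x : pow_set (pow_set S N) (2 * tau) x ->
  exists z a, [/\ prod_set (pow_set S K) A z, A' a & x = (z * a^-1)%g].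
Proof.
have A_cover : coverable T (@ind R G A).
  by apply: coverable_mono A'_cover _ => z; apply: ind_sub.
have v1_ge1 : 1 <= v1.
  by apply: covnum_ind_ge1 => //; case: A_neq0 => a /AA' A'a; exists a.
have phi1 : 2 * covnum T (@ind R G A) <= phi 1%g.
  rewrite -covnumZ//; apply: covnum_mono; first exact: mul_theta_cover.
  move=> z; have [Az|nAz] := pselect (A z).
    by rewrite indT// psi_eq1// theta_eq1//; lra.
  rewrite indF// mulr0 mulr_ge0//; last by case/andP: (theta01 1%g z).
  by case/andP: (psi01 z); lra.
(* The loss along 2 tau steps is 40 v1/N <= (2/15) v1, as N >= 300. It leaves [phi] above v1 >= v0,
   since it starts from at least (4/3) v1. *)
have step_small : 2 * tau%:R * (20 * v1 / K%:R) <= 2 / 15 * v1.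
  have -> : 2 * tau%:R * (20 * v1 / K%:R) = 40 * v1 / N%:R.
    by rewrite /K natrM; field; rewrite !pnatr_eq0 -!lt0n N_gt0 tau_gt0.
  rewrite ler_pdivrMr ?ltr0n//.
  have : 300 <= N%:R :> R by rewrite ler_nat.
  have := v1_ge1; move: v1 (N%:R) => v m; nra.
have large k : (k <= 2 * tau)%N -> 
    v0 < 2 * covnum T (@ind R G A) - k%:R * (20 * v1 / K%:R).
  move=> k2.
  have : k%:R * (20 * v1 / K%:R) <= 2 * tau%:R * (20 * v1 / K%:R).
    rewrite ler_wpM2r// -?natrM ?ler_nat//.
    by rewrite divr_ge0// mulr_ge0//; have := v1_ge1; lra.
  have := covnum_theta_le; have := step_small; have := A'_growth; have := v1_ge1.
  rewrite -/v1; set s := k%:R * _; set t := 2 * tau%:R * _; set j := covnum T _; lra.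
suff: forall k y, (k <= 2 * tau)%N -> pow_set (pow_set S N) k y ->
    2 * covnum T (@ind R G A) - k%:R * (20 * v1 / K%:R) <= phi y.
  move=> H Sx; apply: reach_of_phi; exact: lt_le_trans (large _ (leqnn _)) (H _ _ _ Sx).
elim=> [|k IH] y kt.
  by move=> /pow_set0 ->; rewrite mul0r subr0.
move=> /pow_setS[q [y' [Sq Sy' ->]]].
have IHy := IH y' (ltnW kt) Sy'.
(* The Lipschitz bound needs y' in [W]; this follows from the lower bound for [phi] already proved
   at y'. *)
have [z [a [SAz A'a y'E]]] := reach_of_phi (lt_le_trans (large _ (ltnW kt)) IHy).
have Wy : W y' by rewrite y'E; apply: W_reach.
have := phi_lipschitz Sq Wy; rewrite ler_norml => /andP[+ _].
move: IHy; rewrite -[k.+1]addn1 natrD mulrDl mul1r.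
move: (20 * v1 / K%:R) => e.
lra.
Qed.

End Gleason.

(** * Choice of the parameters *)

Section CoverGrowth.
Variables (R : realType) (G : groupType).
Implicit Types (A L T : set G) (H : G -> R).

(** Inversion turns right translates into the left translates of [fcover], hence the symmetry
    assumptions. *)
Lemma coverable_right_covers A T : sym_set A -> sym_set T -> right_covers T A ->
  coverable T (ind R A).
Proof.
move=> As Ts [F FP]; exists [seq (1, f^-1%g) | f <- F].
split=> [_ /mapP[f _ ->] //|z]; rewrite big_map.
have [Az|nAz] := pselect (A z); last first.
  by rewrite indF//; apply: sumr_ge0 => f _; rewrite mul1r ind_ge0.
have [f Ff /Ts] := FP _ (As _ Az); rewrite invgM !invgK => Tfz.
rewrite indT// (perm_big _ (perm_to_rem Ff)) big_cons /= mul1r invgK indT// lerDl.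
by apply: sumr_ge0 => g _; rewrite mul1r ind_ge0.
Qed.

Lemma covnum_sum_translates T H (F : seq G) : coverable T H ->
  coverable T (fun z => \sum_(g <- F) H (g * z)%g) /\
  covnum T (fun z => \sum_(g <- F) H (g * z)%g) <= (size F)%:R * covnum T H.
Proof.
move=> cH; elim: F => [|g F [cF leF]].
  have c0 : fcover T (fun z => \sum_(g <- [::]) H (g * z)%g) [::].
    by split=> // z; rewrite !big_nil.
  by split; [exists [::] | have := covnum_le c0; rewrite !big_nil mul0r].
have E : (fun z => \sum_(h <- g :: F) H (h * z)%g) =
    (fun z => H (g * z)%g + \sum_(h <- F) H (h * z)%g).
  by apply/funext => z; rewrite big_cons.
rewrite E; have cg := coverable_translate g cH; split; first exact: coverableD.
apply: le_trans (covnumD cg cF) _.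
by rewrite /= -[(size F).+1]add1n natrD mulrDl mul1r covnum_translate// lerD2l.
Qed.

(** For z = x y with x in L^2 and y in L^j, some f in [F] has f x in [L]. So the indicator of
    L^(j+2) is at most the sum over [F] of translates of that of L^(j+1). *)
Lemma covnum_pow_set L T (F : seq G) : thick L L ->
  (forall x, pow_set L 2 x -> exists2 f, f \in F & L (x * f^-1)%g) ->
  thick L T -> forall j,
  covnum T (ind R (pow_set L j.+1)) <= (size F)%:R ^+ j * covnum T (ind R L).
Proof.
move=> tL FP tT; have [L1 Ls _] := tL; have [_ Ts _] := tT.
have cL : right_covers L (pow_set L 2) by exists F.
have cT j : coverable T (ind R (pow_set L j)).
  apply: coverable_right_covers => //; first exact: pow_set_sym.
  exact: thick_cover cL tT.
elim=> [|j IH].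
  rewrite expr0 mul1r; have -> // : pow_set L 1 = L.
  by apply/seteqP; split=> x /pow_set1.
rewrite exprS -mulrA; apply: le_trans (ler_wpM2l (ler0n _ _) IH).
have [cF leF] := covnum_sum_translates F (cT j.+1).
apply: le_trans leF; apply: covnum_mono => // z.
have sum0 (s : seq G) : 0 <= \sum_(g <- s) ind R (pow_set L j.+1) (g * z)%g.
  by apply: sumr_ge0 => g _; rewrite ind_ge0.
have [|nz] := pselect (pow_set L j.+2 z); last by rewrite indF.
rewrite -addn2 addnC => /[dup] Lz /pow_set_split[x [y [Lx Ly zE]]].
rewrite indT//; have [f Ff Lf] := FP _ (pow_setV Ls Lx).
rewrite (perm_big _ (perm_to_rem Ff)) big_cons /= indT ?lerDl//.
rewrite zE mulgA; apply/pow_setS; exists (f * x)%g, y; split=> //.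
by move: Lf => /Ls; rewrite invgM !invgK.
Qed.

End CoverGrowth.

(** The Bernoulli-type bound (3/2)^(2k) >= k + 1, raised to the power [m]. *)
Lemma natr_lt_expr (R : realType) k m : (0 < m)%N ->
  k%:R ^+ m < (3 / 2) ^+ (m * (2 * k)) :> R.
Proof.
move=> m0; rewrite [(m * _)%N]mulnC exprM ltrXn2r ?lt0n_neq0//.
suff: k%:R + 1 <= (3 / 2 : R) ^+ (2 * k) by lra.
elim: k => [|k IH]; first by rewrite expr0 add0r.
have -> : (2 * k.+1 = 2 * k + 2)%N by lia.
rewrite exprD -natr1; have : 0 <= k%:R :> R by [].
by move: IH; move: (_ ^+ (2 * k)) (k%:R) => u v; lra.
Qed.

Lemma slow_step (R : realType) (a : nat -> R) (r : R) J :
  1 <= a 0%N -> a J <= r * a 0%N -> r < (3 / 2) ^+ J ->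
  exists2 j, (j < J)%N & 2 * a j.+1 <= 3 * a j.
Proof.
move=> a0 aJ rJ; apply: contrapT => none.
have grow j : (j <= J)%N -> (3 / 2) ^+ j * a 0%N <= a j.
  elim: j => [|j IH] jJ; first by rewrite expr0 mul1r.
  have := IH (ltnW jJ); rewrite exprS -mulrA.
  have : ~ 2 * a j.+1 <= 3 * a j by move=> le; apply: none; exists j.
  by move=> /negP; rewrite -ltNge; move: (_ ^+ j * _) => u; lra.
have := grow J (leqnn _); suff : r * a 0%N < (3 / 2) ^+ J * a 0%N by lra.
by rewrite ltr_pM2r//; lra.
Qed.

(** * A thick set with bounded powers *)

Section Main.
Variables (G : groupType) (L : set G) (n : nat).
Hypotheses (tL : thick L L) (cL : right_covers L (pow_set L 2)).
Hypotheses (n_gt0 : (0 < n)%N) (expG : forall g : G, (g ^+ n = 1)%g).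

Let R : realType := Rdefinitions.R.

Lemma thick_sub (S T : set G) : S `<=` T -> sym_set T -> thick L S -> thick L T.
Proof.
move=> ST Ts [S1 _ [F FP]]; split=> //; first exact: ST.
by exists F => x /FP[f Ff /ST]; exists f.
Qed.

(** The last set lies in L^(m+1), so its covering number is at most |F|^m times that of [L]. Growth
    by more than 3/2 at each of 2 |F| m steps would exceed this. *)
Lemma slow_covnum T E (m M : nat) (F : seq G) (A := fun j =>
    iter j (fun X => prod_set X (pow_set E M)) L) :
  (0 < m)%N -> (forall x, pow_set L 2 x -> exists2 f, f \in F & L (x * f^-1)%g) ->
  thick L T -> A (m * (2 * size F))%N `<=` pow_set L m.+1 ->
  exists2 j, (j < m * (2 * size F))%N &
    2 * covnum T (ind R (A j.+1)) <= 3 * covnum T (ind R (A j)).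
Proof.
move=> m0 FP tT AJ; have [L1 Ls _] := tL; have [T1 Ts cT] := tT.
have cTL j : coverable T (ind R (pow_set L j)).
  apply: coverable_right_covers => //; first exact: pow_set_sym.
  exact: thick_cover cL tT.
apply: (@slow_step R (fun j => covnum T (ind R (A j))) ((size F)%:R ^+ m)).
- apply: covnum_ind_ge1; first by exists 1%g.
  exact: coverable_right_covers.
- apply: le_trans (covnum_pow_set R tL FP tT m).
  by apply: covnum_mono => // z; apply: ind_sub.
- exact: natr_lt_expr.
Qed.

Lemma iter_prod_set (E : set G) M j :
  iter j (fun X => prod_set X (pow_set E M)) L `<=` prod_set L (pow_set E (j * M)).
Proof.
elim: j => [|j IH] x /=.
  by move=> Lx; exists x => //; exists 1%g; rewrite ?mulg1.
move=> [_ /IH[l Ll [e Ee <-]] [e' Ee' <-]]; exists l => //.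
by exists (e * e')%g; [rewrite mulSnr; apply: pow_set_mul | rewrite mulgA].
Qed.

Lemma bounded_thick :
  exists2 Q, thick L Q & exists B, forall i, pow_set Q i `<=` pow_set L B.
Proof.
have [L1 Ls _] := tL; have [F FP] := cL.
have [N N300] : exists N, (300 <= N)%N by exists 300%N.
(* [E] is S1^(16Nn): a conjugate of [S] lies in (S1^4)^4, and q^i with q in S^N and i < n has fewer
   than Nn factors. The chain multiplies [L] by E^N at most 2 |F| m times. *)
have [m [S1 [m0 tS1 S1L]]] := slow_growth tL cL n_gt0 expG (16 * N * n * N * (2 * size F)).
have [S11 S1s _] := tS1.
pose E := pow_set S1 (16 * N * n).
have E1 : E 1%g by exact: pow_set_one.
have Es : sym_set E by exact: pow_set_sym.
pose A j := iter j (fun X => prod_set X (pow_set E N)) L.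
have A1 j : A j 1%g.
  elim: j => //= j IH; exists 1%g => //; exists 1%g; last by rewrite mulg1.
  exact: pow_set_one.
have AL j : (j <= m * (2 * size F))%N -> A j `<=` pow_set L m.+1.
  move=> jm x /iter_prod_set[l Ll [e Ee <-]]; apply/pow_setS; exists l, e; split=> //.
  apply: S1L; move: Ee; rewrite /E pow_set_pow; apply: pow_set_le => //.
  have -> : (16 * N * n * N * (2 * size F) * m =
    m * (2 * size F) * N * (16 * N * n))%N by ring.
  by rewrite !leq_mul2r jm !orbT.
have [V_F V_FP] : right_covers L (pow_set L (2 * m.+1 + 2 + m)).
  exact: thick_cover cL tL.
(* L^wW contains Q^tau A A'^-1 whenever Q^tau lies in the allowed power of [L]; the further m + 1 in
   [S0] allows for a right factor from A'. *)
pose wW := (beta m (2 * m.+1) (size V_F) + 2 * m.+1)%N.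
pose S0 := conj_core (pow_set L (wW + m.+1)) (pow_set S1 4).
have tS0 : thick L S0 by exact: conj_core_thick.
have [S01 S0s _] := tS0.
pose S := pow_set S0 4.
have S0S : S0 `<=` S by move=> x S0x; apply: (@pow_set_le _ _ 1) => //; apply/pow_set1.
pose T := conj_core (pow_set L m.+1) S.
have tT : thick L T by exact: conj_core_thick.
have [T1 Ts cT] := tT.
have Ss : sym_set S by exact: pow_set_sym.
have S_1 : S 1%g by exact: pow_set_one.
have S_conj g s : pow_set L (wW + m.+1) g -> S s -> pow_set S1 16 (g * s * g^-1)%g.
  move=> Lg; have -> : 16%N = (4 * 4)%N by [].
  by rewrite -pow_set_pow; apply: pow_set_conj => t; apply.
have SS1 : S `<=` pow_set S1 16.
  move=> s /(S_conj 1%g); rewrite mul1g invg1 mulg1; apply; exact: pow_set_one.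
pose Q := pow_set S N.
have QL : Q `<=` pow_set L m.
  move=> q /(pow_set_sub SS1); rewrite pow_set_pow => Sq; apply: S1L.
  apply: pow_set_le Sq => //.
  (* [F] is nonempty because 1 lies in L^2; otherwise the exponent granted by [S1L] would be 0. *)
  have F0 : (0 < size F)%N.
    by have [f] := FP _ (pow_set_one 2 L1); case: (F).
  by have := leq_pmulr (N * 16) (_ : 0 < n * N * (2 * size F) * m)%N; nia.
have E_conj g q i : pow_set S N q -> (i < n)%N -> pow_set L (wW + m.+1) g ->
    E (g * q ^+ i * g^-1)%g.
  move=> Sq lt_in Lg; have := pow_set_expg i Sq; rewrite pow_set_pow => Sqi.
  have := pow_set_conj (S_conj g ^~ Lg) Sqi; rewrite pow_set_pow.
  apply: pow_set_le => //.
  by rewrite -mulnA mulnC [(16 * N)%N]mulnC leq_mul2l ltnW ?orbT.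
exists Q.
  apply: thick_sub tS0; last exact: pow_set_sym.
  move=> x /S0S Sx; apply: (@pow_set_le _ _ 1) => //; last by apply/pow_set1.
  exact: leq_trans N300.
apply: (bounded_powers L1 Ls _ _ QL V_FP); [exact: pow_set_one | exact: pow_set_sym |].
move=> tau tau0 QtauL x Qx.
have [j jm Aj] := slow_covnum m0 FP tT (AL _ (leqnn _)).
have A'L := AL j.+1 jm.
have QS z : pow_set S (N * tau) z -> pow_set Q tau z.
  by rewrite mulnC -pow_set_pow.
have A'V a : prod_set (A j) (pow_set E N) a -> pow_set L m.+1 a^-1%g.
  by move=> /A'L; apply: pow_setV.
have AA' a b : A j a -> prod_set (A j) (pow_set E N) b ->
    pow_set L (2 * m.+1) (a * b^-1)%g.
  move=> Aa A'b; rewrite mul2n -addnn; apply: pow_set_mul; last exact: A'V.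
  exact: AL (ltnW jm) _ Aa.
have [|||||z [a [SAz A'a ->]]] := @gleason_step R G n n_gt0 expG (A j) E S T
  (pow_set L wW) N tau N300 tau0 _ E1 Es S_1 Ss Ts _ _ _ _ Aj x Qx.
- by exists 1%g.
- move=> a t Aa Tt; apply: Tt; exact: AL (ltnW jm) _ Aa.
- move=> q i y a Sq lt_in Wy A'a; rewrite -{2}[(y * a)%g]invgK.
  apply: E_conj Sq lt_in _; rewrite invgM addnC; apply: pow_set_mul; first exact: A'V.
  exact: pow_setV.
- move=> _ a [s Ss' [b Ab <-]] A'a; rewrite -mulgA.
  by apply: pow_set_mul; [apply/QtauL/QS | exact: AA'].
- apply: (coverable_mono _ (fun z => ind_sub R z A'L)).
  apply: coverable_right_covers => //; first exact: pow_set_sym.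
  exact: thick_cover cL tT.
have [s /QS Qs [b Ab zE]] := SAz.
exists s => //; exists (b * a^-1)%g; first exact: AA'.
by rewrite mulgA zE.
Qed.
End Main.

(** * The union of the powers as the required subgroup *)

Lemma coveredP (G : groupType) (X Y : set G) : covered X Y <-> right_covers Y X.
Proof.
split=> [[F /finite_seqP[s ->] XY]|[F FP]].
  by exists s => x /XY[g sg [y Yy <-]]; exists g; rewrite ?mulgK.
exists [set` F]; first exact: finite_seq.
by move=> x /FP[f Ff Yx]; exists f => //; exists (x * f^-1)%g; rewrite ?mulgVK.
Qed.

Lemma subgroup_union_powers (G : groupType) (Q : set G) : sym_set Q ->
  subgroup [set x | exists i, pow_set Q i x].
Proof.
move=> Qs; split; first by rewrite inE; exists 0%N.
move=> x y; rewrite !inE => -[i Qx] [j /(pow_setV Qs) Qy].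
by exists (i + j)%N; apply: pow_set_mul.
Qed.

Theorem corollary5p23 (G : groupType) (hG : bounded_exponent G)
    (L : set G) (hL : approximate_subgroup L) :
  exists2 H : set G, subgroup H & commensurable L H.
Proof.
have [n n_gt0 expG] := hG; have [[L1 LV] [_ /coveredP cLL]] := hL.
have Ls : sym_set L by move=> x Lx; rewrite LV; exists x.
have tL : thick L L by split=> //; exact: right_covers_self.
have cL : right_covers L (pow_set L 2).
  apply: right_covers_sub cLL => x /pow_setS[y [z [Ly /pow_set1 Lz ->]]].
  by exists y => //; exists z.
have [Q tQ [B QB]] := bounded_thick tL cL n_gt0 expG.
have [_ Qs [F FP]] := tQ.
exists [set x | exists i, pow_set Q i x]; first exact: subgroup_union_powers.
(* [L] is covered by translates of [Q], hence of the union; conversely the union lies in L^B, which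
   finitely many translates of [L] cover. *)
split; apply/coveredP.
  by exists F => x /FP[f Ff Qx]; exists f => //; exists 1%N; apply/pow_set1.
by apply: right_covers_sub (thick_cover B tL cL tL) => x [i /QB].
Qed.
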